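(* Let $\rho_1,\rho_2$ be $2\times2$ density matrices with Bloch vectors $\vec r_1,\vec r_2$ of lengths $r_1,r_2\in[0,1)$ and angle $\theta$ between them, and let $\bar\rho=\tfrac12(\rho_1+\rho_2)$. Let $H(x):=\ln2-\tfrac12\big[(1+x)\ln(1+x)+(1-x)\ln(1-x)\big]$ for $x\in[0,1)$ (extended by $H(1):=0$). Then $$\bar r:=\operatorname{OMC}(\bar\rho)=\tfrac12\sqrt{r_1^2+r_2^2+2r_1r_2\cos\theta},\qquad\operatorname{QJSD}(\rho_1,\rho_2)=H(\bar r)-\tfrac12\big[H(r_1)+H(r_2)\big].$$
   Context: A density matrix is a positive semidefinite complex matrix of trace $1$. The Bloch vector of a $2\times2$ density matrix $\rho$ is the vector $\vec r\in\mathbb R^3$ with $\rho=\tfrac12(I+\vec r\cdot\vec\sigma)$, where $\vec\sigma=(\sigma_x,\sigma_y,\sigma_z)$ are the Pauli matrices. (If one of the Bloch vectors is zero, $\theta$ is arbitrary.) For invertible $\rho$, $\kappa(\rho)=\|\rho\|\,\|\rho^{-1}\|$ (operator norm) and $\operatorname{OMC}(\rho)=(\kappa(\rho)-1)/(\kappa(\rho)+1)$. The von Neumann entropy is $S(\rho)=-\sum_i\lambda_i\ln\lambda_i$ over eigenvalues of $\rho$, and the quantum Jensen–Shannon divergence is $\operatorname{QJSD}(\rho_1,\rho_2):=S(\bar\rho)-\tfrac12[S(\rho_1)+S(\rho_2)]$ with $\bar\rho=\tfrac12(\rho_1+\rho_2)$. *)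

(* Defs.v *)
From HB Require Import structures.
From mathcomp Require Import all_boot all_order all_algebra.
From mathcomp Require Import complex.
From mathcomp Require Import all_classical all_reals all_analysis.

Set Implicit Arguments.
Unset Strict Implicit.
Unset Printing Implicit Defensive.

Import Order.TTheory GRing.Theory Num.Theory.

Local Open Scope classical_set_scope.
Local Open Scope sesquilinear_scope.
Local Open Scope complex_scope.
Local Open Scope ring_scope.

(* On [R[i]], [0 <= z] means that [z] is real and nonnegative. *)
Definition psdmx (R : realType) (n : nat) (A : 'M[R[i]]_n) : Prop :=
  A \is hermsymmx /\ forall v : 'cV[R[i]]_n, 0 <= (v ^t* *m A *m v) 0 0.

Definition density_matrix (R : realType) (n : nat) (rho : 'M[R[i]]_n) : Prop :=
  psdmx rho /\ \tr rho = 1.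

Definition sigma_x (R : realType) : 'M[R[i]]_2 :=
  delta_mx 0 1 + delta_mx 1 0.

Definition sigma_y (R : realType) : 'M[R[i]]_2 :=
  - 'i *: delta_mx 0 1 + 'i *: delta_mx 1 0.

Definition sigma_z (R : realType) : 'M[R[i]]_2 :=
  delta_mx 0 0 - delta_mx 1 1.

Definition is_bloch_vector (R : realType) (rho : 'M[R[i]]_2) (r : 'rV[R]_3) :
    Prop :=
  rho = 2^-1 *: (1%:M + ((r 0 0)%:C *: sigma_x R + (r 0 1)%:C *: sigma_y R
                         + (r 0 2)%:C *: sigma_z R)).

Definition dot (R : realType) (n : nat) (u v : 'rV[R]_n) : R :=
  \sum_(k < n) u 0 k * v 0 k.

Definition enorm (R : realType) (n : nat) (u : 'rV[R]_n) : R :=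
  Num.sqrt (dot u u).

(* No constraint on [theta] when one of the vectors is zero. *)
Definition is_angle (R : realType) (n : nat) (u v : 'rV[R]_n) (theta : R) :
    Prop :=
  u != 0 -> v != 0 -> theta = acos (dot u v / (enorm u * enorm v)).

(* The library's norm on matrices is the maximum norm, hence the Euclidean
   norm on [C^n] and the induced operator norm are defined here. *)
Definition l2norm (R : realType) (n : nat) (v : 'cV[R[i]]_n) : R :=
  Num.sqrt (\sum_(k < n) Normc.normc (v k 0) ^+ 2).

Definition opnorm (R : realType) (n : nat) (A : 'M[R[i]]_n) : R :=
  sup [set l2norm (A *m v) | v in [set v : 'cV[R[i]]_n | l2norm v <= 1]].

(* [kappa] and [OMC] are meaningful only when [A \in unitmx]. *)
Definition kappa (R : realType) (n : nat) (A : 'M[R[i]]_n) : R :=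
  opnorm A * opnorm (invmx A).

Definition OMC (R : realType) (n : nat) (A : 'M[R[i]]_n) : R :=
  (kappa A - 1) / (kappa A + 1).

(* The eigenvalues, repeated according to their algebraic multiplicity. *)
Definition spectrum (R : realType) (n : nat) (A : 'M[R[i]]_n) : seq R[i] :=
  sval (closed_field_poly_normal (char_poly A)).

(* The eigenvalues of a density matrix are real and nonnegative, so taking real
   parts is harmless; [ln 0 = 0] gives the convention [0 * ln 0 = 0]. *)
Definition entropy (R : realType) (n : nat) (rho : 'M[R[i]]_n) : R :=
  - \sum_(l <- spectrum rho) complex.Re l * ln (complex.Re l).

Definition midpoint (R : realType) (n : nat) (rho1 rho2 : 'M[R[i]]_n) :
    'M[R[i]]_n :=
  2^-1 *: (rho1 + rho2).

Definition QJSD (R : realType) (n : nat) (rho1 rho2 : 'M[R[i]]_n) : R :=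
  entropy (midpoint rho1 rho2) - 2^-1 * (entropy rho1 + entropy rho2).

Definition H (R : realType) (x : R) : R :=
  if x == 1 then 0
  else ln 2 - 2^-1 * ((1 + x) * ln (1 + x) + (1 - x) * ln (1 - x)).

(* Main.v *)
(** Write rho(u) for the matrix with Bloch vector u, where |u| < 1.  It has
    trace 1 and determinant (1 - |u|^2)/4, hence eigenvalues (1 +- |u|)/2,
    which gives S(rho(u)) = H(|u|).  Since
    |rho(u) w|^2 = (1 + |u|^2)/4 |w|^2 + (u . p)/2, where p is the Bloch vector
    of w, of norm |w|^2, Cauchy-Schwarz bounds the operator norm by
    (1 + |u|)/2, and an explicit eigenvector attains it.  Moreover
    rho(u)^-1 = 4/(1 - |u|^2) rho(-u), so the condition number is
    (1 + |u|)/(1 - |u|) and OMC(rho(u)) = |u|.  Finally, the midpoint of rho(u)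
    and rho(v) is rho((u + v)/2). *)
Require Import Defs.
From mathcomp Require Import all_boot all_order all_algebra.
From mathcomp Require Import complex.
From mathcomp Require Import all_classical all_reals all_analysis.
From mathcomp Require Import ring lra.

Import Order.TTheory GRing.Theory Num.Theory.

Local Open Scope ring_scope.
Local Open Scope complex_scope.

(** * Entrywise computation with complex numbers and small matrices *)

Lemma complex_ext (R : realType) (x y : R[i]) :
  complex.Re x = complex.Re y -> complex.Im x = complex.Im y -> x = y.
Proof. by case: x y => a b [c d] /= -> ->. Qed.

Lemma sum_ord2 (V : nmodType) (F : 'I_2 -> V) : \sum_k F k = F 0 + F 1.
Proof.
by rewrite !big_ord_recl big_ord0 addr0; congr (_ + F _); exact/val_inj.
Qed.

Lemma sum_ord3 (V : nmodType) (F : 'I_3 -> V) : \sum_k F k = F 0 + F 1 + F 2.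
Proof.
rewrite !big_ord_recl big_ord0 addr0 addrA.
by congr (_ + F _ + F _); exact/val_inj.
Qed.

Lemma det_mx22 (K : comNzRingType) (A : 'M[K]_2) :
  \det A = A 0 0 * A 1 1 - A 0 1 * A 1 0.
Proof.
rewrite (expand_det_row _ 0) sum_ord2 /cofactor !det_mx11 !mxE /=.
have -> : lift 0 0 = 1 :> 'I_2 by exact/val_inj.
have -> : lift 1 0 = 0 :> 'I_2 by exact/val_inj.
by rewrite expr0 expr1 mul1r mulN1r mulrN.
Qed.

Lemma ord2_cases (k : 'I_2) : k = 0 \/ k = 1.
Proof. by case: k => [[|[|]]] // lt2; [left | right]; exact/val_inj. Qed.

Lemma matrix22P (T : Type) (A B : 'M[T]_2) :
  A 0 0 = B 0 0 -> A 0 1 = B 0 1 -> A 1 0 = B 1 0 -> A 1 1 = B 1 1 -> A = B.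
Proof.
move=> e00 e01 e10 e11; apply/matrixP => i j.
by case: (ord2_cases i) => ->; case: (ord2_cases j) => ->.
Qed.

Lemma cV2P (T : Type) (v w : 'cV[T]_2) :
  v 0 0 = w 0 0 -> v 1 0 = w 1 0 -> v = w.
Proof.
by move=> e0 e1; apply/colP => k; case: (ord2_cases k) => ->.
Qed.

(** In the embedded form, real and imaginary parts of entries compute. *)
Lemma half_complex (R : realType) : 2^-1 = (2^-1)%:C :> R[i].
Proof. by rewrite fmorphV rmorph_nat. Qed.

(** * Real Euclidean space: Cauchy-Schwarz, angles and midpoints *)

Section EuclideanSpace.
Context {R : realType} {n : nat}.
Implicit Types u v : 'rV[R]_n.

Lemma dot_ge0 u : 0 <= dot u u.
Proof. by apply: sumr_ge0 => k _; rewrite -expr2 sqr_ge0. Qed.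

Lemma dotC u v : dot u v = dot v u.
Proof. by apply: eq_bigr => k _; rewrite mulrC. Qed.

Lemma dot_self_lin (a b : R) u v :
  dot (a *: u + b *: v) (a *: u + b *: v) =
  a ^+ 2 * dot u u + 2 * a * b * dot u v + b ^+ 2 * dot v v.
Proof.
rewrite /dot !mulr_sumr -!big_split /=; apply: eq_bigr => k _.
by rewrite !mxE; ring.
Qed.

Lemma dot0r u : dot u 0 = 0.
Proof. by rewrite /dot big1 // => k _; rewrite mxE mulr0. Qed.

Lemma dot_eq0 u : dot u u = 0 -> u = 0.
Proof.
move/eqP; rewrite psumr_eq0 => [/allP u0|k _]; last by rewrite -expr2 sqr_ge0.
apply/rowP => k; rewrite mxE; apply/eqP.
by have := u0 k (mem_index_enum k); rewrite mulf_eq0 orbb.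
Qed.

Lemma enorm_ge0 u : 0 <= enorm u.
Proof. exact: sqrtr_ge0. Qed.

Lemma sqr_enorm u : enorm u ^+ 2 = dot u u.
Proof. by rewrite sqr_sqrtr // dot_ge0. Qed.

Lemma enorm_gt0 u : u != 0 -> 0 < enorm u.
Proof.
move=> u0; rewrite lt_def enorm_ge0 andbT; apply: contraNneq u0 => nu0.
by apply/eqP/dot_eq0; rewrite -sqr_enorm nu0 expr0n.
Qed.

Lemma enormN u : enorm (- u) = enorm u.
Proof.
by rewrite /enorm; congr Num.sqrt; apply: eq_bigr => k _; rewrite !mxE mulrNN.
Qed.

Lemma enorm0 : enorm (0 : 'rV[R]_n) = 0.
Proof. by rewrite /enorm dot0r sqrtr0. Qed.

(* Expand |(v.v) u - (u.v) v|^2 >= 0. *)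
Lemma ler_dot_enorm u v : `|dot u v| <= enorm u * enorm v.
Proof.
rewrite -(@ler_pXn2r _ 2) ?nnegrE ?mulr_ge0 ?enorm_ge0 //.
rewrite real_normK ?num_real // exprMn !sqr_enorm.
have [/dot_eq0 -> | v0] := eqVneq (dot v v) 0;
  first by rewrite !dot0r expr0n mulr0.
have v_gt0 : 0 < dot v v by rewrite lt_def v0 dot_ge0.
have := dot_ge0 (dot v v *: u + (- dot u v) *: v); rewrite dot_self_lin => h.
by rewrite -subr_ge0 -(pmulr_rge0 _ v_gt0); lra.
Qed.

(** If a vector is zero, both sides vanish, so [theta] may be arbitrary. Otherwise [cos] undoes
    [acos], since Cauchy-Schwarz puts the quotient in [-1, 1]. *)
Lemma dot_cos_angle u v theta : is_angle u v theta ->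
  dot u v = enorm u * enorm v * cos theta.
Proof.
have [->|u0] := eqVneq u 0; first by rewrite dotC dot0r enorm0 !mul0r.
have [->|v0] := eqVneq v 0; first by rewrite dot0r enorm0 mulr0 mul0r.
have uv_gt0 : 0 < enorm u * enorm v by rewrite mulr_gt0 ?enorm_gt0.
move/(_ u0 v0) ->; rewrite acosK; first by rewrite mulrC divfK // gt_eqF.
rewrite in_itv /= ler_pdivlMr // ler_pdivrMr // mulN1r mul1r -ler_norml.
exact: ler_dot_enorm.
Qed.

Lemma sqr_enorm_midpoint u v :
  4 * enorm (2^-1 *: u + 2^-1 *: v) ^+ 2 =
  enorm u ^+ 2 + enorm v ^+ 2 + 2 * dot u v.
Proof. by rewrite !sqr_enorm dot_self_lin; field. Qed.

(** By Cauchy-Schwarz, four times the squared norm of the midpoint is at most a^2 + b^2 + 2ab < 4,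
    where a = |u| and b = |v|. *)
Lemma enorm_midpoint_lt1 u v :
  enorm u < 1 -> enorm v < 1 -> enorm (2^-1 *: u + 2^-1 *: v) < 1.
Proof.
move=> u1 v1; rewrite -(@ltr_pXn2r _ 2) ?nnegrE ?enorm_ge0 // expr1n.
have := sqr_enorm_midpoint u v; have := ler_norm (dot u v).
have := ler_dot_enorm u v; have := enorm_ge0 u; have := enorm_ge0 v.
set w := _ + _; move: (enorm u) (enorm v) (enorm w) (dot u v) u1 v1.
move=> a b c d a1 b1 b0 a0.
have : a * b < 1 by rewrite mulr_ilt1.
have : a ^+ 2 < 1 by rewrite expr_lt1.
have : b ^+ 2 < 1 by rewrite expr_lt1.
lra.
Qed.

End EuclideanSpace.

(** * The Hermitian norm and the operator norm *)

Section L2Norm.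
Context {R : realType}.

Lemma l2norm_ge0 n (w : 'cV[R[i]]_n) : 0 <= l2norm w.
Proof. exact: sqrtr_ge0. Qed.

(** Removes the nested square roots, which makes norm estimates polynomial in real coordinates. *)
Lemma sqr_l2norm n (w : 'cV[R[i]]_n) :
  l2norm w ^+ 2 =
  \sum_k (complex.Re (w k 0) ^+ 2 + complex.Im (w k 0) ^+ 2).
Proof.
rewrite sqr_sqrtr; last by apply: sumr_ge0 => k _; rewrite sqr_ge0.
apply: eq_bigr => k _; case: (w k 0) => a b /=.
by rewrite sqr_sqrtr // addr_ge0 // sqr_ge0.
Qed.

Lemma l2normZ n (c : R) (w : 'cV[R[i]]_n) :
  0 <= c -> l2norm (c%:C *: w) = c * l2norm w.
Proof.
move=> c0; apply/eqP; rewrite -(@eqrXn2 _ 2) ?mulr_ge0 ?l2norm_ge0 //.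
rewrite exprMn !sqr_l2norm mulr_sumr; apply/eqP/eq_bigr => k _.
rewrite mxE; case: (w k 0) => a b /=; ring.
Qed.

Lemma l2norm_gt0 n (w : 'cV[R[i]]_n) : w != 0 -> 0 < l2norm w.
Proof.
move=> w0; rewrite lt_def l2norm_ge0 andbT; apply: contraNneq w0 => nw0.
have : l2norm w ^+ 2 = 0 by rewrite nw0 expr0n.
rewrite sqr_l2norm => /eqP; rewrite psumr_eq0 => [/allP w0|k _]; last first.
  by rewrite addr_ge0 ?sqr_ge0.
apply/eqP/colP => k; rewrite mxE; have := w0 k (mem_index_enum k).
rewrite paddr_eq0 ?sqr_ge0 // !sqrf_eq0 => /andP[/eqP re0 /eqP im0].
by case: (w k 0) re0 im0 => a b /= -> ->.
Qed.

(** The bound [c] holds on the whole unit ball and is attained at the normalised eigenvector, so it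
    is the supremum. *)
Lemma opnorm_eigenvector n (A : 'M[R[i]]_n) (c : R) (w : 'cV[R[i]]_n) :
  0 <= c -> (forall v, l2norm (A *m v) <= c * l2norm v) ->
  w != 0 -> A *m w = c%:C *: w -> opnorm A = c.
Proof.
move=> c0 leA w0 Aw; have w_gt0 := l2norm_gt0 _ _ w0.
apply/eqP; rewrite eq_le; apply/andP; split.
  apply: ge_sup.
    (* The zero vector shows that the set of values is nonempty. *)
    by exists (l2norm (A *m 0)), 0 => //=; rewrite -(scale0r 0) l2normZ ?mul0r.
  move=> _ [v /= v1 <-]; apply: le_trans (leA v) _.
  by rewrite ler_piMr.
apply: ub_le_sup.
  exists c => _ [v /= v1 <-]; apply: le_trans (leA v) _.
  by rewrite ler_piMr.
exists ((l2norm w)^-1%:C *: w) => /=.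
  by rewrite l2normZ ?invr_ge0 ?l2norm_ge0 // mulVf ?gt_eqF.
rewrite -scalemxAr Aw scalerA mulrC -scalerA.
by rewrite !l2normZ ?invr_ge0 ?l2norm_ge0 // mulVf ?gt_eqF ?mulr1.
Qed.

End L2Norm.

(** * Bloch matrices: entries, determinant and inverse *)

Section BlochMatrix.
Context {R : realType}.
Implicit Types u : 'rV[R]_3.

(** Chosen so that [is_bloch_vector rho u] is by conversion [rho = bloch_mx u]. *)
Definition bloch_mx u : 'M[R[i]]_2 :=
  2^-1 *: (1%:M + ((u 0 0)%:C *: sigma_x R + (u 0 1)%:C *: sigma_y R
                   + (u 0 2)%:C *: sigma_z R)).

Lemma dot_rV3 u : dot u u = u 0 0 ^+ 2 + u 0 1 ^+ 2 + u 0 2 ^+ 2.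
Proof. by rewrite /dot sum_ord3. Qed.

Lemma bloch_mxE u :
  [/\ bloch_mx u 0 0 = ((1 + u 0 2) / 2)%:C,
      bloch_mx u 0 1 = (u 0 0 / 2) -i* (u 0 1 / 2),
      bloch_mx u 1 0 = (u 0 0 / 2) +i* (u 0 1 / 2)
    & bloch_mx u 1 1 = ((1 - u 0 2) / 2)%:C].
Proof.
rewrite /bloch_mx half_complex /sigma_x /sigma_y /sigma_z -complexiE.
split; rewrite !mxE; apply: complex_ext;
by rewrite /= ?mulr0n ?mulr1n /=; field.
Qed.

Lemma tr_bloch_mx u : \tr (bloch_mx u) = 1.
Proof.
have [e00 _ _ e11] := bloch_mxE u.
by rewrite /mxtrace sum_ord2 e00 e11; apply: complex_ext => /=; field.
Qed.

Lemma det_bloch_mx u : \det (bloch_mx u) = ((1 - enorm u ^+ 2) / 4)%:C.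
Proof.
have [e00 e01 e10 e11] := bloch_mxE u.
rewrite det_mx22 e00 e01 e10 e11 sqr_enorm dot_rV3.
by apply: complex_ext => /=; field.
Qed.

Lemma bloch_mx_unit u : enorm u < 1 -> bloch_mx u \in unitmx.
Proof.
move=> u1; rewrite unitmxE unitfE det_bloch_mx fmorph_eq0.
rewrite mulf_neq0 ?invr_eq0 ?pnatr_eq0 //.
by rewrite subr_eq0 eq_sym lt_eqF // expr_lt1 ?enorm_ge0.
Qed.

(** The adjugate of rho(u) is rho(-u), and the scalar is the inverse of the determinant. *)
Lemma invmx_bloch_mx u : enorm u < 1 ->
  invmx (bloch_mx u) = (4 / (1 - enorm u ^+ 2))%:C *: bloch_mx (- u).
Proof.
move=> u1; have U := bloch_mx_unit _ u1.
apply: (can_inj (mulKmx U)); rewrite mulmxV // -scalemxAr.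
have [e00 e01 e10 e11] := bloch_mxE u.
have [f00 f01 f10 f11] := bloch_mxE (- u).
have : 1 - enorm u ^+ 2 != 0
  by rewrite subr_eq0 eq_sym lt_eqF // expr_lt1 ?enorm_ge0.
rewrite sqr_enorm dot_rV3 => n0.
move: (bloch_mx u) (bloch_mx (- u)) e00 e01 e10 e11 f00 f01 f10 f11 {U}.
move=> A B e00 e01 e10 e11; rewrite !mxE => f00 f01 f10 f11.
apply: matrix22P;
  rewrite !mxE sum_ord2 ?e00 ?e01 ?e10 ?e11 ?f00 ?f01 ?f10 ?f11;
  apply: complex_ext;
by rewrite /= ?mulr1n ?mulr0n /=; field.
Qed.

(** * Operator norm and condition number of a Bloch matrix *)

Lemma l2norm_bloch_mx_le u (w : 'cV[R[i]]_2) :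
  l2norm (bloch_mx u *m w) <= (1 + enorm u) / 2 * l2norm w.
Proof.
have n0 := enorm_ge0 u; have nn : enorm u ^+ 2 = _ := sqr_enorm u.
have c0 : 0 <= (1 + enorm u) / 2 by rewrite divr_ge0 // addr_ge0.
rewrite -(@ler_pXn2r _ 2) ?nnegrE ?l2norm_ge0 ?(mulr_ge0 c0) ?l2norm_ge0 //.
rewrite exprMn.
have [e00 e01 e10 e11] := bloch_mxE u.
move: (bloch_mx u) e00 e01 e10 e11 => A e00 e01 e10 e11.
rewrite !sqr_l2norm !sum_ord2 !mxE !sum_ord2 e00 e01 e10 e11.
rewrite dot_rV3 in nn.
case: (w 0 0) => a b; case: (w 1 0) => c d /=.
(* [p] is the (unnormalised) Bloch vector of [w]. *)
pose p : 'rV[R]_3 := \row_k [:: 2 * (a * c + b * d); 2 * (a * d - b * c);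
  a ^+ 2 + b ^+ 2 - (c ^+ 2 + d ^+ 2)]`_k.
have np : enorm p = a ^+ 2 + b ^+ 2 + (c ^+ 2 + d ^+ 2).
  rewrite /enorm dot_rV3 !mxE /=.
  rewrite -[RHS]ger0_norm -?sqrtr_sqr; last by rewrite !addr_ge0 ?sqr_ge0.
  by congr Num.sqrt; ring.
have := le_trans (ler_norm _) (ler_dot_enorm u p).
rewrite np /dot sum_ord3 !mxE /=.
move: (u 0 0) (u 0 1) (u 0 2) (enorm u) nn n0 {c0} => x y z n nn n0 h.
rewrite -subr_ge0.
set t := (X in 0 <= X).
(* The gap is half the Cauchy-Schwarz defect |u||p| - u.p, plus a multiple of n^2 - |u|^2, which is
   zero by [nn]. *)
have -> : t = (n * (a ^+ 2 + b ^+ 2 + (c ^+ 2 + d ^+ 2)) -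
    (x * (2 * (a * c + b * d)) + y * (2 * (a * d - b * c)) +
     z * (a ^+ 2 + b ^+ 2 - (c ^+ 2 + d ^+ 2)))) / 2 +
    (n ^+ 2 - (x ^+ 2 + y ^+ 2 + z ^+ 2)) / 4 *
    (a ^+ 2 + b ^+ 2 + (c ^+ 2 + d ^+ 2)).
  by rewrite /t; field.
by rewrite nn subrr !mul0r addr0 divr_ge0 // subr_ge0.
Qed.

Lemma bloch_mx_eigenvector u : exists2 w : 'cV[R[i]]_2, w != 0 &
  bloch_mx u *m w = ((1 + enorm u) / 2)%:C *: w.
Proof.
have [e00 e01 e10 e11] := bloch_mxE u.
have nn : enorm u ^+ 2 = _ := sqr_enorm u; rewrite dot_rV3 in nn.
move: (bloch_mx u) e00 e01 e10 e11 => A e00 e01 e10 e11.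
have [nz|nz] := eqVneq (enorm u + u 0 2) 0; last first.
  (* Twice the first column of rho(u) - (1 - |u|)/2: by Cayley-Hamilton, the columns of this matrix
     are killed by rho(u) - (1 + |u|)/2. *)
  exists (\col_k [:: (enorm u + u 0 2)%:C; u 0 0 +i* u 0 1]`_k).
    apply: contra_neq nz => /colP/(_ 0); rewrite !mxE /= => /eqP.
    by rewrite fmorph_eq0 => /eqP.
  apply: cV2P; rewrite !mxE sum_ord2 ?e00 ?e01 ?e10 ?e11 !mxE /=;
    apply: complex_ext => /=; clear - nn;
    move: (u 0 0) (u 0 1) (u 0 2) (enorm u) nn => x y z n nn; lra.
(* That column may now vanish, but [u] lies on the z-axis, so rho(u) is diagonal and the second
   basis vector has eigenvalue (1 + |u|)/2. *)
have uz : u 0 2 = - enorm u by apply/eqP; rewrite -addr_eq0 addrC nz.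
have [x0 y0] : u 0 0 = 0 /\ u 0 1 = 0 by clear -nn uz; split; nra.
exists (\col_k [:: 0; 1]`_k).
  by apply/eqP => /colP/(_ 1); rewrite !mxE /= => /eqP; rewrite oner_eq0.
apply: cV2P; rewrite !mxE sum_ord2 ?e00 ?e01 ?e10 ?e11 !mxE /= uz x0 y0;
by apply: complex_ext => /=; field.
Qed.

(** The factor [k] lets one formula serve rho(u) and its inverse, a positive multiple of rho(-u). *)
Lemma opnorm_scale_bloch_mx k u : 0 <= k ->
  opnorm (k%:C *: bloch_mx u) = k * ((1 + enorm u) / 2).
Proof.
move=> k0; have [w w0 Aw] := bloch_mx_eigenvector u.
have n0 := enorm_ge0 u.
apply: (opnorm_eigenvector _ _ _ w) => //.
- by rewrite mulr_ge0 // divr_ge0 // addr_ge0.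
- move=> v; rewrite -scalemxAl l2normZ // -mulrA ler_wpM2l //.
  exact: l2norm_bloch_mx_le.
- by rewrite -scalemxAl Aw scalerA -rmorphM.
Qed.

Lemma OMC_bloch_mx u : enorm u < 1 -> OMC (bloch_mx u) = enorm u.
Proof.
move=> u1; have n0 := enorm_ge0 u.
have n1 : enorm u ^+ 2 < 1 by rewrite expr_lt1.
have opA := opnorm_scale_bloch_mx 1 u ler01.
rewrite rmorph1 scale1r mul1r in opA.
have opB : opnorm (invmx (bloch_mx u)) =
    4 / (1 - enorm u ^+ 2) * ((1 + enorm u) / 2).
  rewrite invmx_bloch_mx // -(enormN u); apply: opnorm_scale_bloch_mx.
  by rewrite enormN divr_ge0 // subr_ge0 ltW.
have kappaE : kappa (bloch_mx u) = (1 + enorm u) / (1 - enorm u).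
  rewrite /kappa opA opB.
  by field; clear - u1 n0 n1; apply/andP; split; apply/eqP; lra.
(* Here kappa - 1 = 2|u|/(1 - |u|) and kappa + 1 = 2/(1 - |u|). *)
by rewrite /OMC kappaE; field; clear - u1 n0 n1;
  apply/andP; split; apply/eqP; lra.
Qed.

(** * Spectrum, entropy and midpoints of Bloch matrices *)

Lemma perm_spectrum_bloch_mx u :
  perm_eq (spectrum (bloch_mx u))
    [:: ((1 + enorm u) / 2)%:C; ((1 - enorm u) / 2)%:C].
Proof.
(* The order of the chosen list of roots is unspecified, hence a statement up to permutation. Its
   two members are found from their sum, the trace, and their product, the determinant. *)
rewrite /spectrum; case: closed_field_poly_normal => s /=.
rewrite (monicP (char_poly_monic _)) scale1r => def_s.
have sz : size s = 2.
  by have := size_char_poly (bloch_mx u); rewrite def_s size_prod_XsubC => -[].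
case: s sz def_s => [|a [|b []]] // _ def_s.
have def_p : char_poly (bloch_mx u) = 'X^2 - (a + b)%:P * 'X + (a * b)%:P.
  by rewrite def_s !big_cons big_nil polyCD polyCM; ring.
have ab : a + b = 1.
  have := char_poly_trace (bloch_mx u) isT.
  rewrite tr_bloch_mx def_p !coefE /= => /eqP.
  by rewrite mulr1 sub0r addr0 eqr_opp => /eqP.
have abp : a * b = ((1 - enorm u ^+ 2) / 4)%:C.
  have := char_poly_det (bloch_mx u).
  by rewrite det_bloch_mx def_p !coefE /= mulr0 subr0 add0r sqrrN expr1n mul1r.
(* The expected eigenvalues have the same sum and product as [a] and [b], so [a] is one of them; [b]
   = 1 - [a] is then the other. *)
have /eqP : (a - ((1 + enorm u) / 2)%:C) * (a - ((1 - enorm u) / 2)%:C) = 0.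
  have -> : ((1 - enorm u) / 2)%:C = a + b - ((1 + enorm u) / 2)%:C.
    by rewrite ab; apply: complex_ext => /=; field.
  set c := ((1 + enorm u) / 2)%:C.
  have : a * b = c * (a + b - c).
    by rewrite abp ab; apply: complex_ext => /=; field.
  move=> e; transitivity (c * (a + b - c) - a * b); first by ring.
  by rewrite -e subrr.
have -> : b = 1 - a by rewrite -ab addrC addKr.
rewrite mulf_eq0 !subr_eq0 => /orP[] /eqP ->.
  rewrite (_ : 1 - _ = ((1 - enorm u) / 2)%:C) //.
  by apply: complex_ext => /=; field.
rewrite (_ : 1 - _ = ((1 + enorm u) / 2)%:C).
  exact/permPl/(perm_catC [:: _] [:: _]).
by apply: complex_ext => /=; field.
Qed.

(** Splitting ln((1 +- |u|)/2) gives [ln 2] with total weight 1, the sum of the eigenvalues. Both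
    logarithms have positive arguments because |u| < 1. *)
Lemma entropy_bloch_mx u : enorm u < 1 -> entropy (bloch_mx u) = H (enorm u).
Proof.
move=> u1; have n0 := enorm_ge0 u.
have p_gt0 : 0 < 1 + enorm u by rewrite ltr_pwDl.
have m_gt0 : 0 < 1 - enorm u by rewrite subr_gt0.
rewrite /entropy (perm_big _ (perm_spectrum_bloch_mx u)) !big_cons big_nil /=.
rewrite /H lt_eqF // !ln_div ?posrE //.
by field.
Qed.

(** Holds because rho(u) is affine in u. *)
Lemma midpoint_bloch_mx u v :
  midpoint (bloch_mx u) (bloch_mx v) = bloch_mx (2^-1 *: u + 2^-1 *: v).
Proof.
rewrite /midpoint half_complex.
have [e00 e01 e10 e11] := bloch_mxE u.
have [f00 f01 f10 f11] := bloch_mxE v.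
have [] := bloch_mxE (2^-1 *: u + 2^-1 *: v).
move: (bloch_mx u) (bloch_mx v) (bloch_mx _) e00 e01 e10 e11 f00 f01 f10 f11.
move=> A B C e00 e01 e10 e11 f00 f01 f10 f11; rewrite !mxE => g00 g01 g10 g11.
apply: matrix22P;
  rewrite !mxE ?g00 ?g01 ?g10 ?g11 ?e00 ?e01 ?e10 ?e11 ?f00 ?f01 ?f10 ?f11;
by apply: complex_ext => /=; field.
Qed.

End BlochMatrix.

Theorem proposition5p26 (R : realType) (rho1 rho2 : 'M[R[i]]_2)
    (v1 v2 : 'rV[R]_3) (r1 r2 theta : R)
    (hrho1 : density_matrix rho1) (hrho2 : density_matrix rho2)
    (hv1 : is_bloch_vector rho1 v1) (hv2 : is_bloch_vector rho2 v2)
    (hr1 : r1 = enorm v1) (hr2 : r2 = enorm v2)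
    (hr1_lt1 : r1 < 1) (hr2_lt1 : r2 < 1)
    (htheta : is_angle v1 v2 theta) :
  let rhobar := midpoint rho1 rho2 in
  let rbar := OMC rhobar in
  [/\ rhobar \in unitmx,
      rbar = 2^-1 * Num.sqrt (r1 ^+ 2 + r2 ^+ 2 + 2 * r1 * r2 * cos theta)
    & QJSD rho1 rho2 = H rbar - 2^-1 * (H r1 + H r2)].
Proof.
have {hrho1 hv1} -> : rho1 = bloch_mx v1 by exact: hv1.
have {hrho2 hv2} -> : rho2 = bloch_mx v2 by exact: hv2.
subst r1 r2; cbv zeta.
have lt1 := enorm_midpoint_lt1 _ _ hr1_lt1 hr2_lt1.
rewrite /QJSD midpoint_bloch_mx (OMC_bloch_mx _ lt1).
split; [exact: bloch_mx_unit | |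
  by congr (_ - _ * (_ + _)); exact: entropy_bloch_mx].
(* The cosine term becomes 2 v1.v2, so the radicand is the square of twice the norm of the midpoint
   of [v1] and [v2]. *)
rewrite -!mulrA (mulrA (enorm v1)) -dot_cos_angle // -sqr_enorm_midpoint.
set w := _ + _; rewrite (_ : 4 * _ = (2 * enorm w) ^+ 2); last by ring.
by rewrite sqrtr_sqr ger0_norm ?mulr_ge0 ?enorm_ge0 // mulKf.
Qed.
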